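(* Let $G$ be a finite abelian group. If $S$ is a primitive formally dual set of rank three in $G$, then $S$ is an $(n,n,n,1)$ relative difference set in $G$ with $n>1$.
   Context: For a group isomorphism $\Delta:G\to\widehat G$, $y\mapsto\chi_y$, subsets $S,T\subseteq G$ form a formally dual pair if for all $y\in G$: $|\chi_y(S)|^2=\frac{|S|^2}{|T|}\nu_T(y)$ and $|\chi_y(T)|^2=\frac{|T|^2}{|S|}\nu_S(y)$, where $\chi(A)=\sum_{a\in A}\chi(a)$ and $\nu_A(y)=|\{(a_1,a_2)\in A\times A\mid y=a_1a_2^{-1}\}|$. A subset is primitive if it is not contained in a coset of a proper subgroup and is not a union of cosets of a nontrivial subgroup; $S$ is a primitive formally dual set if there exist such $\Delta$ and $T$ with both $S,T$ primitive and forming a formally dual pair. $S$ is an even set if, in $\mathbb{Z}[G]$, $SS^{(-1)}=\sum_{i=1}^r\lambda_iH_i$ for some subgroups $H_i$ (identified with the sum of their elements) and nonzero integers $\lambda_i$, where $S^{(-1)}=\sum_{s\in S}s^{-1}$; its rank is the smallest such $r$. For $G$ of order $mn$ and a subgroup $N$ of order $n$, a $k$-subset $R$ is an $(m,n,k,\lambda)$ relative difference set relative to $N$ if $RR^{(-1)}=k\cdot1+\lambda(G-N)$ in $\mathbb{Z}[G]$; an $(n,n,n,1)$ relative difference set in $G$ means one relative to some subgroup $N$ of order $n$, with $|G|=n^2$. *)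

(* Defs.v *)
From HB Require Import structures.
From mathcomp Require Import all_boot all_order all_algebra all_fingroup.
From mathcomp Require Import all_solvable all_field all_character.

Set Implicit Arguments.
Unset Strict Implicit.
Unset Printing Implicit Defensive.

Import GroupScope GRing.Theory.
Local Open Scope ring_scope.

(* The integral group ring Z[gT] under convolution. The alias is needed since
   {ffun gT -> int} already carries the pointwise product. For G : {group gT},
   Z[G] is the subring of elements supported on G. *)
Definition zgring (gT : finGroupType) : Type := {ffun gT -> int}.

HB.instance Definition _ (gT : finGroupType) :=
  GRing.Zmodule.copy (zgring gT) {ffun gT -> int}.

Definition zg_elt (gT : finGroupType) (x : gT) : zgring gT :=
  [ffun z => (z == x)%:R].

Definition zg_mul (gT : finGroupType) (a b : zgring gT) : zgring gT :=
  [ffun z => \sum_(x : gT) a x * b (x^-1 * z)%g].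

Section GroupRing.
Variable gT : finGroupType.
Implicit Types a b c : zgring gT.

Fact zg_mulA : associative (@zg_mul gT).
Proof.
move=> a b c; apply/ffunP=> z; rewrite !ffunE.
under eq_bigr => x _ do rewrite ffunE big_distrr /=.
under [RHS]eq_bigr => x _ do rewrite ffunE big_distrl /=.
rewrite [RHS]exchange_big /=; apply: eq_bigr => x _.
rewrite [RHS](reindex_inj (mulgI x)) /=; apply: eq_bigr => y _.
by rewrite mulrA mulKg invMg mulgA.
Qed.

Fact zg_mul1r : left_id (zg_elt 1%g) (@zg_mul gT).
Proof.
move=> a; apply/ffunP=> z; rewrite ffunE (bigD1 1%g) //= big1 => [|x ntx].
  by rewrite ffunE eqxx mul1r invg1 mul1g addr0.
by rewrite ffunE (negPf ntx) mul0r.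
Qed.

Fact zg_mulr1 : right_id (zg_elt 1%g) (@zg_mul gT).
Proof.
move=> a; apply/ffunP=> z; rewrite ffunE (bigD1 z) //= big1 => [|x ntx].
  by rewrite ffunE mulVg eqxx mulr1 addr0.
by rewrite ffunE -eq_mulVg1 (negPf ntx) mulr0.
Qed.

Fact zg_mulDl : left_distributive (@zg_mul gT) +%R.
Proof.
move=> a b c; apply/ffunP=> z; rewrite !ffunE -big_split /=.
by apply: eq_bigr => x _; rewrite ffunE mulrDl.
Qed.

Fact zg_mulDr : right_distributive (@zg_mul gT) +%R.
Proof.
move=> a b c; apply/ffunP=> z; rewrite !ffunE -big_split /=.
by apply: eq_bigr => x _; rewrite ffunE mulrDr.
Qed.

Fact zg_oner_neq0 : zg_elt (1%g : gT) != 0.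
Proof. by apply/eqP=> /ffunP/(_ 1%g); rewrite !ffunE eqxx. Qed.

HB.instance Definition _ := GRing.Zmodule_isNzRing.Build (zgring gT)
  zg_mulA zg_mul1r zg_mulr1 zg_mulDl zg_mulDr zg_oner_neq0.

End GroupRing.

Definition zg_set (gT : finGroupType) (A : {set gT}) : zgring gT :=
  \sum_(x in A) zg_elt x.

Definition zg_setV (gT : finGroupType) (A : {set gT}) : zgring gT :=
  \sum_(x in A) zg_elt x^-1%g.

(* The product of 'CF(G) is pointwise, so this says that y |-> chi y restricts
   to a group isomorphism from G onto the group of linear characters of G; for
   G abelian the latter is the whole dual group of G. *)
Definition dual_isom (gT : finGroupType) (G : {group gT})
    (chi : gT -> 'CF(G)) : Prop :=
  [/\ forall y, y \in G -> chi y \is a linear_char,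
      {in G &, {morph chi : x y / (x * y)%g >-> x * y}},
      {in G &, injective chi}
    & forall xi : 'CF(G), xi \is a linear_char ->
        exists2 y, y \in G & chi y = xi].

Definition char_sum (gT : finGroupType) (G : {group gT}) (xi : 'CF(G))
    (A : {set gT}) : algC :=
  \sum_(a in A) xi a.

Definition nu (gT : finGroupType) (A : {set gT}) (y : gT) : nat :=
  #|[set p in setX A A | y == (p.1 * p.2^-1)%g]|.

(* Division by zero is harmless: if one of the sets is empty, then the
   equations at y = 1 force the other to be empty as well. *)
Definition formally_dual_pair (gT : finGroupType) (G : {group gT})
    (chi : gT -> 'CF(G)) (S T : {set gT}) : Prop :=
  forall y, y \in G ->
    `|char_sum (chi y) S| ^+ 2 = #|S|%:R ^+ 2 / #|T|%:R * (nu T y)%:R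
    /\ `|char_sum (chi y) T| ^+ 2 = #|T|%:R ^+ 2 / #|S|%:R * (nu S y)%:R.

Definition primitive_set (gT : finGroupType) (G : {group gT})
    (S : {set gT}) : Prop :=
  ~ (exists (H : {group gT}) (x : gT),
       [/\ H \proper G, x \in G & S \subset H :* x])
  /\ ~ (exists (H : {group gT}) (P : {set {set gT}}),
          [/\ H \subset G, H :!=: 1%g, P \subset rcosets H G & S = cover P]).

Definition primitive_formally_dual (gT : finGroupType) (G : {group gT})
    (S : {set gT}) : Prop :=
  exists (chi : gT -> 'CF(G)) (T : {set gT}),
    [/\ dual_isom chi, T \subset G, primitive_set G S, primitive_set G T
      & formally_dual_pair chi S T].

Definition even_decomposition (gT : finGroupType) (G : {group gT})
    (S : {set gT}) (r : nat) : Prop :=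
  exists (H : 'I_r -> {group gT}) (lam : 'I_r -> int),
    (forall i, H i \subset G /\ lam i != 0)
    /\ zg_set S * zg_setV S = \sum_(i < r) zg_set (H i) *~ lam i.

(* S is an even set, and its rank is r. *)
Definition even_set_of_rank (gT : finGroupType) (G : {group gT})
    (S : {set gT}) (r : nat) : Prop :=
  even_decomposition G S r
  /\ (forall r', even_decomposition G S r' -> (r <= r')%N).

Definition relative_difference_set (gT : finGroupType) (G N : {group gT})
    (m n k lam : nat) (R : {set gT}) : Prop :=
  [/\ N \subset G, #|G| = (m * n)%N, #|N| = n, R \subset G & #|R| = k]
  /\ zg_set R * zg_setV R =
       zg_elt 1%g *+ k + (zg_set G - zg_set N) *+ lam.

(* Main.v *)
(* Write SS^(-1) as the combination of subgroups H_1, H_2, H_3, with integer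
   coefficients lam_i. By duality nu_T is a combination of the annihilators of
   the H_i, so differences of elements of S lie in the union of the H_i, and
   those of T in the union of the annihilators. A set with differences in
   A u B u C that is in no proper coset satisfies AB = G unless C = G. Applied
   to S this gives H_i H_j = G unless H_k = G; applied to T it gives that H_i
   and H_j meet trivially unless H_k = 1.
   If the subgroups 1 and G both occur, then integrality of nu_S and nu_T
   together with |S||T| = |G| forces SS^(-1) = |S| + G - N with |N| = |S|.
   Otherwise the H_i are pairwise complements, so |H_i| = |S|; an element of S
   has at most one partner in its coset of H_i, so lam_i (|S| - 1) <= |S|,
   whence lam_i = 1 and |S| = 3, and S is a (3,3,3,1) relative difference set
   relative to the fourth subgroup of order 3 of G. *)
Require Import Defs.
From mathcomp Require Import all_boot all_order all_algebra all_fingroup.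
From mathcomp Require Import all_solvable all_field all_character.
From mathcomp Require Import zify ring.

Set Implicit Arguments.
Unset Strict Implicit.
Unset Printing Implicit Defensive.

Import GroupScope Order.TTheory GRing.Theory Num.Theory.
Local Open Scope ring_scope.

(** * Triples of distinct indices *)

Lemma ord3_cover (i j k l : 'I_3) :
  uniq [:: i; j; k] -> [|| l == i, l == j | l == k].
Proof.
by case: i => [] [|[|[|]]] //; case: j => [] [|[|[|]]] //;
  case: k => [] [|[|[|]]] //; case: l => [] [|[|[|]]].
Qed.

Lemma big_ord3 (R : nmodType) (F : 'I_3 -> R) (i j k : 'I_3) :
  uniq [:: i; j; k] -> \sum_(l < 3) F l = F i + F j + F k.
Proof.
move=> u; rewrite (bigD1 i) //= (bigD1 j) /=; last first.
  by move: u; rewrite /= !inE negb_or eq_sym; case/andP=> /andP[].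
rewrite (big_pred1 k) ?addrA // => l; move: u (ord3_cover l u).
rewrite /= !inE negb_or !andbT.
case/andP=> /andP[ij ik] jk /or3P[]/eqP->; rewrite eqxx ?andbF //=.
- by rewrite (negPf ik).
- by rewrite (negPf jk).
- by rewrite !(eq_sym k) ik jk.
Qed.

Lemma uniq3P (T : eqType) (i j k : T) :
  uniq [:: i; j; k] -> [/\ i != j, i != k & j != k].
Proof. by rewrite /= !inE negb_or andbT => /andP[/andP[-> ->] ->]. Qed.

Lemma ord3_third (i j : 'I_3) : i != j -> exists k, uniq [:: i; j; k].
Proof.
(* The three residues modulo 3 sum to 0. *)
move=> ij; exists (- (i + j)).
by case: i j ij => [] [|[|[|]]] // ? [] [|[|[|]]].
Qed.

Lemma ord3_others (i : 'I_3) : exists j k, uniq [:: i; j; k].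
Proof.
have [|k u] := @ord3_third i (ordS i); first by case: i => [] [|[|[|]]].
by exists (ordS i), k.
Qed.

(** * Coefficients in the group ring *)

Section GroupRingCoefficients.
Variable gT : finGroupType.
Implicit Types (A S : {set gT}) (z : gT).

Lemma zg_setE A z : zg_set A z = (z \in A)%:R.
Proof.
rewrite /zg_set sum_ffunE.
under eq_bigr => x _ do rewrite ffunE.
case: (boolP (z \in A)) => zA.
  rewrite (bigD1 z) //= eqxx big1 ?addr0 // => x /andP[_].
  by rewrite eq_sym => /negPf ->.
by rewrite big1 // => x xA; case: eqP => // zx; rewrite zx xA in zA.
Qed.

Lemma zg_mulz (a : zgring gT) (n : int) z : (a *~ n) z = a z *~ n.
Proof.
case: n => n; first exact: ffunMnE.
by rewrite NegzE !mulrNz ffunE; congr (- _); apply: ffunMnE.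
Qed.

Lemma zg_setVE A z : zg_setV A z = (z^-1%g \in A)%:R.
Proof.
rewrite -zg_setE /zg_setV /zg_set !sum_ffunE.
by apply: eq_bigr => x _; rewrite !ffunE eq_invg_sym eq_sym.
Qed.

Lemma nuE S z : nu S z = (\sum_(a in S) ((z^-1 * a)%g \in S))%N.
Proof.
rewrite -big_mkcondr /= sum1dep_card /nu.
rewrite -(@card_imset _ _ (fun a => (a, (z^-1 * a)%g))) => [|a b [] //].
apply: eq_card => -[a b]; rewrite !inE /=; apply/andP/imsetP.
  case=> /andP[aS bS] /eqP e; exists a; last by rewrite e invMg invgK mulgKV.
  by rewrite !inE aS e invMg invgK mulgKV.
case=> c; rewrite !inE => /andP[cS zcS] [-> ->]; rewrite cS zcS.
by rewrite invMg invgK mulKVg.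
Qed.

Lemma zg_set_mulVE S z : (zg_set S * zg_setV S : zgring gT) z = (nu S z)%:Z.
Proof.
rewrite ffunE nuE -[RHS]natz natr_sum [in RHS]big_mkcond.
apply: eq_bigr => x _ /=.
rewrite zg_setE zg_setVE invMg invgK.
by case: (x \in S); rewrite ?mul1r ?mul0r.
Qed.

Lemma nu_gt0P S z :
  reflect (exists a b, [/\ a \in S, b \in S & z = (a * b^-1)%g]) (0 < nu S z)%N.
Proof.
rewrite /nu card_gt0; apply: (iffP (set0Pn _)) => [[[a b]]|[a [b [aS bS ->]]]].
  by rewrite !inE /= => /andP[/andP[aS bS] /eqP->]; exists a, b.
by exists (a, b); rewrite !inE /= aS bS eqxx.
Qed.

Lemma nu1 S : nu S 1%g = #|S|.
Proof.
rewrite nuE -sum1_card; apply: eq_bigr => a aS.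
by rewrite invg1 mul1g aS.
Qed.

Lemma nu_out (G : {group gT}) S z : S \subset G -> z \notin G -> nu S z = 0%N.
Proof.
move=> sSG zG; apply/eqP; rewrite -leqn0 leqNgt; apply/negP.
case/nu_gt0P=> a [b [aS bS zE]]; move: zG.
by rewrite zE groupM ?groupV ?(subsetP sSG).
Qed.

Lemma sum_nu S (F : gT -> algC) :
  \sum_z F z *+ nu S z = \sum_(a in S) \sum_(b in S) F (a * b^-1)%g.
Proof.
under eq_bigr => z _ do rewrite nuE -sumrMnr.
rewrite exchange_big; apply: eq_bigr => a aS /=.
rewrite [RHS]big_mkcond (reindex_inj (mulgI a)) (reindex_inj invg_inj) /=.
by apply: eq_bigr => b _; rewrite invMg invgK mulgKV mulrb.
Qed.

Lemma sum_nu_card S : (\sum_z nu S z)%N = (#|S| ^ 2)%N.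
Proof.
apply/eqP; rewrite -(eqr_nat algC) natr_sum.
have := sum_nu S (fun _ => 1); under eq_bigr => z _ do rewrite -[1 *+ _]/(_%:R).
move->; rewrite (eq_bigr (fun _ => #|S|%:R)) => [|a _]; last first.
  by rewrite sumr_const.
by rewrite sumr_const -mulrnA mulnn.
Qed.
End GroupRingCoefficients.

(** * Sets whose differences lie in three subgroups *)

Section Coset.
Variables (gT : finGroupType) (G A B C : {group gT}) (S : {set gT}).

(* If S met two cosets of A B, elements in different ones would be
   congruent modulo C, hence so would any two elements of S. *)
Lemma mulg_eq_of_differences :
  abelian G -> S \subset G -> A \subset G -> B \subset G -> C \subset G ->
  (forall (H : {group gT}) x,
     H \proper G -> x \in G -> ~~ (S \subset H :* x)) ->
  {in S &, forall s s', (s * s'^-1)%g \in A :|: B :|: C} ->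
  C :!=: G -> (A * B)%g = G.
Proof.
move=> abG sSG sAG sBG sCG ncS dS nCG.
have jE: A <*> B = (A * B)%g.
  by apply: cent_joinEr; apply: sub_abelian_cent2 abG _ _.
have sMG: A <*> B \subset G by rewrite join_subG sAG.
have prC: C \proper G by rewrite properEneq nCG.
rewrite -jE; apply/eqP; apply: contraT => nMG.
have prM: (A <*> B)%G \proper G by rewrite properEneq nMG.
have /subsetPn[s0 s0S _] := ncS _ _ prC (group1 G).
have /subsetPn[s1 s1S s1M] := ncS _ _ prM (subsetP sSG _ s0S).
have /subsetPn[s sS sC] := ncS _ _ prC (subsetP sSG _ s0S).
have dC t t': t \in S -> t' \in S -> (t * t'^-1)%g \notin (A <*> B)%G ->
    (t * t'^-1)%g \in C.
  move=> tS t'S; have := dS _ _ tS t'S; rewrite !inE => /orP[|//].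
  case/orP=> [/(subsetP (joing_subl A B)) -> //|].
  by move/(subsetP (joing_subr A B)) ->.
rewrite mem_rcoset in s1M; rewrite mem_rcoset in sC.
case/negP: sC; case: (boolP ((s * s0^-1)%g \in (A <*> B)%G)) => [sM|].
  2: exact: dC.
(* Now [s] lies in the coset [A B s0] and [s1] does not, so [s s1^-1] and [s1 s0^-1] both avoid
   [A B] and hence lie in [C]. *)
rewrite -[s](mulgKV s1) -mulgA groupM ?dC //.
apply: contra s1M => sM1.
by rewrite -[s1](mulgKV s) -mulgA groupM // -groupV invMg invgK.
Qed.
End Coset.

(** * Annihilators and Fourier transform *)

Lemma lin_cfkerE (gT : finGroupType) (G : {group gT}) (xi : 'CF(G)) x :
  xi \is a linear_char -> (x \in cfker xi) = (x \in G) && (xi x == 1).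
Proof.
by move=> Lxi; rewrite cfkerEchar ?lin_charW // inE lin_char1.
Qed.

(** Orthogonality: if [h] in [H] has [xi h != 1], translating by [h] multiplies the sum by [xi h],
    so the sum vanishes. *)
Lemma sum_lin_char (gT : finGroupType) (G H : {group gT}) (xi : 'CF(G)) :
  xi \is a linear_char -> H \subset G ->
  \sum_(x in H) xi x = #|H|%:R *+ (H \subset cfker xi).
Proof.
move=> Lxi sHG; case: (boolP (H \subset cfker xi)) => [kH|/subsetPn[h hH]].
  rewrite (eq_bigr (fun _ => 1)) ?sumr_const // => x /(subsetP kH).
  by rewrite lin_cfkerE // => /andP[_ /eqP].
rewrite lin_cfkerE // (subsetP sHG) //= => xih.
apply/eqP; have: (xi h - 1) * \sum_(x in H) xi x == 0.
  rewrite mulrBl mul1r subr_eq0 mulr_sumr [eqbRHS](reindex_inj (mulgI h)) /=.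
  apply/eqP; apply: eq_big => [x|x xH]; first by rewrite groupMl.
  by rewrite lin_charM // (subsetP sHG).
by rewrite mulf_eq0 subr_eq0 (negPf xih).
Qed.

(** The conjugate of [xi b] is [xi b^-1], so the squared modulus expands over the quotients of pairs
    in [S]. *)
Lemma norm_char_sum (gT : finGroupType) (G : {group gT}) (xi : 'CF(G))
    (S : {set gT}) :
  xi \is a linear_char -> S \subset G ->
  `|char_sum xi S| ^+ 2 = \sum_z xi z *+ nu S z.
Proof.
move=> Lxi sSG; rewrite sum_nu normCK rmorph_sum mulr_suml.
apply: eq_bigr => a aS; rewrite mulr_sumr; apply: eq_bigr => b bS.
by rewrite lin_charM ?groupV ?(subsetP sSG) // lin_charV_conj ?(subsetP sSG).
Qed.

Section Dual.
Variables (gT : finGroupType) (G : {group gT}) (chi : gT -> 'CF(G)).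
Hypotheses (abG : abelian G) (dchi : dual_isom chi).
Implicit Types (H A B : {group gT}) (S T : {set gT}).

Lemma dual_lin y : y \in G -> chi y \is a linear_char.
Proof. by case: dchi => + _ _ _; apply. Qed.

(** [H] is the intersection of the kernels of the irreducible characters containing it; as [G] is
    abelian these are linear, so each is some [chi y]. *)
Lemma dual_separates H x : H \subset G -> x \in G -> x \notin H ->
  exists y, [/\ y \in G, H \subset cfker (chi y) & chi y x != 1].
Proof.
move=> sHG xG xH; have nHG : H <| G by rewrite -sub_abelian_normal.
move: xH; rewrite -{1}(cap_cfker_normal nHG) => /bigcapP nx.
have [i kH kx] : exists2 i, H \subset cfker 'chi[G]_i & x \notin cfker 'chi_i.
  apply/exists_inP; rewrite -negb_forall_in; apply/negP=> /forall_inP xk.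
  exact: nx.
have Li : 'chi_i \is a linear_char by apply/char_abelianP.
have [y yG yi] : exists2 y, y \in G & chi y = 'chi_i.
  by case: dchi => _ _ _; apply.
by exists y; rewrite yi; split=> //; move: kx; rewrite lin_cfkerE // xG.
Qed.

(** The annihilator of [H] in the dual group, pulled back to [G] along [chi]. *)
Definition perp H := [set y in G | H \subset cfker (chi y)].

Lemma perp_group_set H : H \subset G -> group_set (perp H).
Proof.
move=> sHG; case: dchi => Lchi Mchi _ _.
have perpP y : y \in G ->
    reflect {in H, forall h, chi y h = 1} (H \subset cfker (chi y)).
  move=> yG; apply: (iffP subsetP) => k h hH; have := k h hH.
    by rewrite lin_cfkerE ?Lchi // => /andP[_ /eqP].
  by rewrite lin_cfkerE ?Lchi // (subsetP sHG h hH) => ->; rewrite eqxx.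
apply/group_setP; split=> [|x y]; rewrite !inE.
  rewrite group1; apply/perpP => // h hH.
  (* [chi 1] is idempotent with nonzero values on [G], hence equal to 1 there. *)
  have := Mchi _ _ (group1 G) (group1 G); rewrite mulg1 => /cfunP/(_ h).
  rewrite cfunE => e.
  have /(mulIf _)-> // : 1 * chi 1%g h = chi 1%g h * chi 1%g h.
    by rewrite mul1r.
  by apply: lin_char_neq0; rewrite ?Lchi ?(subsetP sHG).
case/andP=> xG /(perpP _ xG) kx /andP[yG /(perpP _ yG) ky].
rewrite groupM //; apply/perpP => [|h hH]; rewrite ?groupM //.
by rewrite Mchi // cfunE kx // ky // mulr1.
Qed.

(** An element of both [A] and [B] is killed by both annihilators, hence by every character. This
    turns product statements about [T] into intersection statements about [S]. *)
Lemma perp_mul_TI A B (sAG : A \subset G) (sBG : B \subset G) :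
  (perp A * perp B)%g = G -> A :&: B = 1%g.
Proof.
move=> AB; apply/trivgP/subsetP=> x /setIP[xA xB]; rewrite inE.
apply: contraT => x1; have xG := subsetP sAG x xA.
have [|y [yG _ /eqP[]]] := dual_separates (sub1G G) xG; first by rewrite inE.
have: y \in (perp A * perp B)%g by rewrite AB.
case/mulsgP=> a b; rewrite !inE.
case/andP=> aG ka /andP[bG kb ->]; have [_ Mchi _ _] := dchi.
rewrite Mchi // cfunE; move/subsetP/(_ x xA): ka; move/subsetP/(_ x xB): kb.
rewrite !lin_cfkerE ?dual_lin // => /andP[_ /eqP ->] /andP[_ /eqP ->].
by rewrite mulr1.
Qed.

(** The other orthogonality relation: for [x != 1] some [chi y0 x] differs from 1, and shifting [y]
    by [y0] multiplies the sum by it. *)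
Lemma sum_dual x : x \in G -> \sum_(y in G) chi y x = #|G|%:R *+ (x == 1%g).
Proof.
move=> xG; case: eqP => [->|/eqP x1].
  rewrite (eq_bigr (fun _ => 1)) ?sumr_const // => y yG.
  by rewrite lin_char1 ?dual_lin.
have [|y0 [y0G _ y0x]] := dual_separates (sub1G G) xG; first by rewrite inE.
have [_ Mchi _ _] := dchi.
apply/eqP; have: (chi y0 x - 1) * \sum_(y in G) chi y x == 0.
  rewrite mulrBl mul1r subr_eq0 mulr_sumr [eqbRHS](reindex_inj (mulgI y0)) /=.
  apply/eqP; apply: eq_big => [y|y yG]; first by rewrite groupMl.
  by rewrite Mchi // cfunE.
by rewrite mulf_eq0 subr_eq0 (negPf y0x).
Qed.

Lemma perp_eqG H : H \subset G -> perp H = G -> H :=: 1%g.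
Proof.
move=> sHG pH; rewrite -(setIid H); apply: perp_mul_TI => //.
by rewrite pH mulGid.
Qed.

Section Pair.
Variables S T : {set gT}.
Hypotheses (sSG : S \subset G) (sTG : T \subset G).
Hypotheses (S0 : S != set0) (fdp : formally_dual_pair chi S T).

(** Division by zero gives zero, so an empty [T] would turn the equation at [y = 1] into
    [|S|^2 = 0]. *)
Lemma fdp_T0 : T != set0.
Proof.
apply: (contraNneq _ S0) => T0; have [+ _] := fdp (group1 G).
rewrite T0 cards0 invr0 mulr0 mul0r => /eqP; rewrite expf_eq0 /= normr_eq0.
rewrite /char_sum (eq_bigr (fun _ => 1)) => [|a aS].
  by rewrite sumr_const pnatr_eq0 cards_eq0.
have [_ Mchi _ _] := dchi.
have := Mchi _ _ (group1 G) (group1 G); rewrite mulg1 => /cfunP/(_ a).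
rewrite cfunE -{1}[chi 1%g a]mul1r => /(mulIf _) <- //.
by apply: lin_char_neq0; rewrite ?dual_lin ?(subsetP sSG a aS).
Qed.

(** The sum of [|chi_y(S)|^2] over [y] is [|G||S|] by orthogonality and [(|S|^2/|T|) |T|^2] by
    duality. *)
Lemma fdp_card : (#|S| * #|T|)%N = #|G|.
Proof.
have S_neq0 : #|S|%:R != 0 :> algC by rewrite pnatr_eq0 cards_eq0.
have T_neq0 : #|T|%:R != 0 :> algC by rewrite pnatr_eq0 cards_eq0 fdp_T0.
have: \sum_(y in G) `|char_sum (chi y) S| ^+ 2 = #|G|%:R * #|S|%:R.
  under eq_bigr => y yG do rewrite norm_char_sum ?dual_lin //.
  rewrite exchange_big (bigD1 1%g) //= [X in _ + X]big1 ?addr0 => [|z z1].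
    by rewrite sumrMnl sum_dual // eqxx nu1 mulr_natr.
  rewrite sumrMnl; case: (boolP (z \in G)) => zG.
    by rewrite sum_dual // (negPf z1) mul0rn.
  by rewrite (nu_out sSG zG) mulr0n.
under eq_bigr => y yG do rewrite (fdp yG).1.
rewrite -mulr_sumr -natr_sum.
rewrite (_ : (\sum_(y in G) nu T y)%N = (#|T| ^ 2)%N); last first.
  rewrite -sum_nu_card big_mkcond; apply: eq_bigr => y _.
  by case: ifPn => // /(nu_out sTG) ->.
move=> e; apply/eqP; rewrite -(eqr_nat algC) natrM; apply/eqP.
apply: (mulfI S_neq0); rewrite [RHS]mulrC -e natrX; field.
exact: T_neq0.
Qed.

(** Fourier transform of the decomposition of [SS^(-1)]: the indicator of [H l] becomes [|H l|]
    times that of its annihilator. *)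
Lemma fdp_nu (r : nat) (H : 'I_r -> {group gT}) (lam : 'I_r -> int) y :
  (forall l, H l \subset G) ->
  (forall z, (nu S z)%:Z = \sum_l lam l * (z \in H l)%:R) -> y \in G ->
  #|S|%:R ^+ 2 / #|T|%:R * (nu T y)%:R
    = \sum_l (lam l)%:~R * #|H l|%:R * (y \in perp (H l))%:R :> algC.
Proof.
move=> sHG nuS yG; rewrite -(fdp yG).1 norm_char_sum ?dual_lin //.
transitivity (\sum_z \sum_l (lam l)%:~R * (chi y z *+ (z \in H l))).
  apply: eq_bigr => z _; rewrite -[LHS]mulr_natr -[(nu S z)%:R]/((nu S z)%:~R).
  rewrite nuS rmorph_sum mulr_sumr; apply: eq_bigr => l _ /=.
  by rewrite intrM mulrz_nat -[in RHS]mulr_natr mulrCA.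
rewrite exchange_big; apply: eq_bigr => l _ /=.
rewrite -mulr_sumr -mulrA; congr (_ * _).
transitivity (\sum_(z in H l) chi y z).
  by rewrite [RHS]big_mkcond; apply: eq_bigr => z _; rewrite mulrb.
by rewrite sum_lin_char ?dual_lin // inE yG mulr_natr.
Qed.
End Pair.
End Dual.

(** * Recognising relative difference sets; minimality of the rank *)

Lemma relative_difference_set_nu (gT : finGroupType) (G N : {group gT})
    (S : {set gT}) (n : nat) :
  [/\ N \subset G, #|G| = (n * n)%N, #|N| = n, S \subset G & #|S| = n] ->
  (forall z, (nu S z)%:Z =
     n%:R * (z == 1%g)%:R + (z \in G)%:R - (z \in N)%:R) ->
  relative_difference_set G N n n n 1 S.
Proof.
move=> cards nuS; split=> //; apply/ffunP=> z; rewrite zg_set_mulVE nuS.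
rewrite mulr1n -addrA [in RHS]ffunE; congr (_ + _).
  by rewrite [RHS]ffunMnE ffunE mulr_natl.
by rewrite !ffunE !zg_setE.
Qed.

Section Rank.
Variables (gT : finGroupType) (G : {group gT}) (S : {set gT}).

(** Terms with zero coefficient must be dropped, whence only a bound on [r]. *)
Lemma even_decomposition2 (A B : {group gT}) (a b : int) :
  A \subset G -> B \subset G ->
  zg_set S * zg_setV S = zg_set A *~ a + zg_set B *~ b ->
  exists2 r, (r <= 2)%N & even_decomposition G S r.
Proof.
move=> sA sB SE; have [a0|na0] := eqVneq a 0.
  have [b0|nb0] := eqVneq b 0.
    exists 0%N => //; exists (fun=> 1%G), (fun=> 1); split=> [[]//|].
    by rewrite big_ord0 SE a0 b0 !mulr0z addr0.
  exists 1%N => //; exists (fun=> B), (fun=> b); split=> //.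
  by rewrite big_ord1 SE a0 mulr0z add0r.
have [b0|nb0] := eqVneq b 0.
  exists 1%N => //; exists (fun=> A), (fun=> a); split=> //.
  by rewrite big_ord1 SE b0 mulr0z addr0.
exists 2%N => //; exists (fun i => if i == 0 then A else B).
exists (fun i => if i == 0 then a else b); split=> [i|]; first by case: eqP.
by rewrite SE !big_ord_recl big_ord0 addr0.
Qed.

(** Equal subgroups could be merged into one term, leaving at most two. *)
Lemma rank3_inj (H : 'I_3 -> {group gT}) (lam : 'I_3 -> int) (i j k : 'I_3) :
  (forall r, even_decomposition G S r -> (3 <= r)%N) ->
  (forall l, H l \subset G) ->
  zg_set S * zg_setV S = \sum_(l < 3) zg_set (H l) *~ lam l ->
  uniq [:: i; j; k] -> H i :!=: H j.
Proof.
move=> minr sHG SE u; apply/eqP => Hij.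
have [|||r r2 /minr] :=
  @even_decomposition2 (H j) (H k) (lam i + lam j) (lam k).
- exact: sHG.
- exact: sHG.
- by rewrite SE (big_ord3 _ u) Hij mulrzDr.
by rewrite leqNgt ltnS r2.
Qed.
End Rank.

(** * Counting differences inside one of the three subgroups *)

Section Partner.
Variables (gT : finGroupType) (A B C : {group gT}) (S : {set gT}).
Hypotheses (AB : A :&: B = 1%g) (AC : A :&: C = 1%g).
Hypothesis ncS : forall x, x \in S -> ~~ (S \subset A :* x).
Hypothesis dS : {in S &, forall s s', (s * s'^-1)%g \in A :|: B :|: C}.

(* Take s in S outside the coset A a. Each of the elements of S in A a is
   congruent to s modulo B or modulo C, and two of them cannot be congruent
   to s modulo the same subgroup. *)
Lemma partner_unique a z z' :
  a \in S -> z \in A -> z' \in A -> z != 1%g -> z' != 1%g ->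
  (z^-1 * a)%g \in S -> (z'^-1 * a)%g \in S -> z = z'.
Proof.
move=> aS zA z'A z1 z'1 zaS z'aS.
have /subsetPn[s sS] := ncS aS; rewrite mem_rcoset => sA.
have sBC w : w \in A -> (w^-1 * a)%g \in S ->
    ((s * a^-1 * w)%g \in B) || ((s * a^-1 * w)%g \in C).
  move=> wA waS; have := dS sS waS; rewrite invMg invgK mulgA !inE -orbA.
  by rewrite groupMr // (negPf sA).
have inj (D : {group gT}) w w' : A :&: D = 1%g -> w \in A -> w' \in A ->
    (s * a^-1 * w)%g \in D -> (s * a^-1 * w')%g \in D -> w = w'.
  move=> AD wA w'A wD w'D; apply/eqP; rewrite eq_mulVg1 -in_set1 -[[set 1%g]]AD.
  rewrite inE groupM ?groupV //=.
  have := groupM (groupVr wD) w'D.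
  by rewrite !invMg -!mulgA !(mulKg, mulKVg).
have a1 : (1^-1 * a)%g \in S by rewrite invg1 mul1g.
have n1 w : w != 1%g -> w <> 1%g by move/eqP.
(* Pigeonhole: of [z], [z'] and [1], two fall under the same subgroup [B] or [C] and so coincide;
   only [z = z'] is possible. *)
case/orP: (sBC _ zA zaS) => zD; case/orP: (sBC _ z'A z'aS) => z'D;
  case/orP: (sBC _ (group1 A) a1) => oD;
  by [ exact: inj AB zA z'A zD z'D | exact: inj AC zA z'A zD z'D
     | case/n1: z1; apply: inj AB _ _ zD oD
     | case/n1: z1; apply: inj AC _ _ zD oD
     | case/n1: z'1; apply: inj AB _ _ z'D oD
     | case/n1: z'1; apply: inj AC _ _ z'D oD].
Qed.

(** Double counting: each [a] in [S] contributes at most one [z]. *)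
Lemma sum_nu_le : (\sum_(z in A | z != 1%g) nu S z <= #|S|)%N.
Proof.
under eq_bigr => z _ do rewrite nuE.
rewrite exchange_big -sum1_card; apply: leq_sum => a aS.
rewrite -big_mkcondr /= sum1dep_card; apply/card_le1_eqP => z z'.
rewrite !inE => /andP[/andP[zA z1] zaS] /andP[/andP[z'A z'1] z'aS].
exact: (partner_unique aS z'A zA z'1 z1 z'aS zaS).
Qed.
End Partner.

(** * Subgroups 1, N and G *)

Lemma chain_arith (m t n g a b c d : nat) (li lj lk : int) :
  (0 < m)%N -> (0 < t)%N -> g = (m * t)%N ->
  b%:Z = lk -> c%:Z = li + lk -> lk != 0 -> lj != 0 ->
  m%:Z ^+ 2 * a%:Z = t%:Z * lj ->
  m%:Z ^+ 2 * d%:Z = t%:Z * (li * n%:Z + lj) ->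
  m%:Z ^+ 2 * t%:Z = t%:Z * (li * n%:Z + lj + lk * g%:Z) ->
  m%:Z = li + lj + lk ->
  [/\ lj = m, li = -1, lk = 1, n = m & t = m].
Proof.
move=> m0 t0 -> <- cE b0 j0 e1 e2 e3 f1.
have tZ : t%:Z != 0 by lia.
have ljm : lj <= m%:Z by lia.
have a0 : (0 < a)%N.
  case: a e1 => // /eqP.
  by rewrite mulr0 eq_sym mulf_eq0 (negPf tZ) (negPf j0).
have b1 : (0 < b)%N by lia.
have amt : (a * m <= t)%N.
  have : t%:Z * lj <= t%:Z * m%:Z by rewrite ler_pM2l // ltz_nat.
  rewrite -e1 => h; have : (m * (a * m) <= m * t)%N by lia.
  by rewrite leq_pmul2l.
have e4 : m%:Z ^+ 2 = li * n%:Z + lj + b%:Z * (m%:Z * t%:Z).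
  by apply: (mulfI tZ); rewrite mulrC e3 PoszM.
have btm : (b * t <= m)%N.
  have h : 0 <= li * n%:Z + lj.
    by rewrite -(@pmulr_rge0 _ t%:Z) ?ltz_nat // -e2 -!rmorphXn -PoszM.
  have : (m * (b * t) <= m * m)%N by lia.
  by rewrite leq_pmul2l.
have tm : t = m.
  apply/eqP; rewrite eqn_leq (leq_trans _ btm) ?(leq_trans _ amt) //.
    by rewrite leq_pmull.
  by rewrite leq_pmull.
subst t.
have aE : a = 1%N by apply/eqP; rewrite eqn_leq a0 andbT -(leq_pmul2r m0) mul1n.
have bE : b = 1%N by apply/eqP; rewrite eqn_leq b1 andbT -(leq_pmul2r m0) mul1n.
subst a b; have ljE : lj = m%:Z.
  by apply: (mulfI tZ); rewrite -e1 mulr1 expr2.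
by split=> //; nia.
Qed.

Section Chain.
Variables (gT : finGroupType) (G : {group gT}) (chi : gT -> 'CF(G)).
Variables (S T : {set gT}) (H : 'I_3 -> {group gT}) (lam : 'I_3 -> int).
Variables (i j k : 'I_3).
Hypotheses (abG : abelian G) (dchi : dual_isom chi).
Hypotheses (sSG : S \subset G) (sTG : T \subset G) (S0 : S != set0).
Hypothesis fdp : formally_dual_pair chi S T.
Hypotheses (sHG : forall l, H l \subset G) (lam0 : forall l, lam l != 0).
Hypothesis nuS : forall z, (nu S z)%:Z = \sum_l lam l * (z \in H l)%:R.
Hypothesis u : uniq [:: i; j; k].
Hypotheses (Hi1 : H i :!=: 1%g) (HiG : H i :!=: G).
Hypotheses (Hj : H j :=: 1%g) (Hk : H k :=: G).

Lemma chain_relative_difference_set :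
  relative_difference_set G (H i) #|S| #|S| #|S| 1 S.
Proof.
have [w wH w1] := trivgPn _ Hi1; have wG := subsetP (sHG i) w wH.
have [z zG zH] : exists2 z, z \in G & z \notin H i.
  by apply/subsetPn; apply: contra HiG => sGH; rewrite eqEsubset sHG.
have T0 := fdp_T0 dchi sSG S0 fdp; have ST := fdp_card abG dchi sSG sTG S0 fdp.
have m0 : (0 < #|S|)%N by rewrite card_gt0.
have t0 : (0 < #|T|)%N by rewrite card_gt0.
(* [y1] is outside the annihilator of [H i]; [y2] is a nontrivial element of it. *)
have [|y1 [y1G _ y1w]] := dual_separates abG dchi (sub1G G) wG.
  by rewrite inE.
have [y2 [y2G y2H y2z]] := dual_separates abG dchi (sHG i) zG zH.
have fdpZ y : y \in G -> (#|S|%:Z ^+ 2 * (nu T y)%:Z = #|T|%:Z *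
    (lam i * #|H i|%:Z * (y \in perp chi (H i))%:R + lam j
     + lam k * #|G|%:Z * (y \in perp chi G)%:R)).
  move=> yG; apply: (@intr_inj algC); rewrite !rmorphM /=.
  have := fdp_nu dchi sSG fdp sHG nuS yG.
  rewrite (big_ord3 _ u) !inE yG Hj Hk sub1G cards1 !mulr1.
  move/(congr1 ( *%R #|T|%:R)).
  rewrite mulrA [_ * (_ / _)]mulrC divfK ?pnatr_eq0 -?lt0n //.
  by rewrite -[#|T|%:~R]/(#|T|%:R) -[#|S|%:~R]/(#|S|%:R) => ->;
    rewrite !rmorphD !rmorphM /= !rmorph_nat.
have y1E : y1 \in perp chi (H i) = false.
  rewrite inE y1G; apply: contraNF y1w => /subsetP/(_ w wH).
  by rewrite lin_cfkerE ?(dual_lin dchi) // => /andP[].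
have y2E : y2 \in perp chi (H i) by rewrite inE y2G.
have pGE y : y \in perp chi G -> forall x, x \in G -> chi y x == 1.
  rewrite inE => /andP[yG /subsetP kx] x /kx.
  by rewrite lin_cfkerE ?(dual_lin dchi) // => /andP[].
have y1E' : y1 \in perp chi G = false.
  by apply: contraNF y1w => /pGE->.
have y2E' : y2 \in perp chi G = false.
  by apply: contraNF y2z => /pGE->.
have one_perp (A : {group gT}) : A \subset G -> 1%g \in perp chi A.
  by move=> sAG; case/group_setP: (perp_group_set dchi sAG).
have := fdpZ _ y1G; rewrite y1E y1E' !mulr0 add0r addr0 => e1.
have := fdpZ _ y2G; rewrite y2E y2E' mulr0 addr0 mulr1 => e2.
have := fdpZ _ (group1 G); rewrite nu1 !one_perp // !mulr1 => e3.
have := nuS 1%g; rewrite nu1 (big_ord3 _ u) !group1 !mulr1 => f1.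
have := nuS w; rewrite (big_ord3 _ u) wH Hj Hk inE (negPf w1) wG.
rewrite !mulr1 mulr0 addr0 => f2.
have := nuS z; rewrite (big_ord3 _ u) (negPf zH) Hj Hk zG inE.
rewrite (_ : (z == 1%g) = false) ?mulr1 ?mulr0 ?add0r; last first.
  by apply: contraNF zH => /eqP->; apply: group1.
move=> f3.
have [ljE liE lkE Ni Te] :=
  chain_arith m0 t0 (esym ST) f3 f2 (lam0 k) (lam0 j) e1 e2 e3 f1.
apply: relative_difference_set_nu; first by split=> //; rewrite -ST Te.
move=> x; rewrite nuS (big_ord3 _ u) Hj Hk inE ljE liE lkE natz mul1r mulN1r.
by ring.
Qed.
End Chain.

(** * Pairwise complementary subgroups *)

Section PairwiseComplements.
Variables (gT : finGroupType) (G : {group gT}) (S : {set gT}).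
Variables (H : 'I_3 -> {group gT}) (lam : 'I_3 -> int).
Hypotheses (abG : abelian G) (sSG : S \subset G) (S0 : S != set0).
Hypothesis ncS : forall (A : {group gT}) x,
  A \proper G -> x \in G -> ~~ (S \subset A :* x).
Hypotheses (sHG : forall l, H l \subset G) (lam0 : forall l, lam l != 0).
Hypothesis nuS : forall z, (nu S z)%:Z = \sum_l lam l * (z \in H l)%:R.
Hypothesis H1 : forall l, H l :!=: 1%g.
Hypothesis HM : forall l l', l != l' -> (H l * H l')%g = G.
Hypothesis HI : forall l l', l != l' -> H l :&: H l' = 1%g.

Variables o p q : 'I_3.
Hypothesis opq : uniq [:: o; p; q].

(** Each pair of orders multiplies to [|G|], so the three orders agree. *)
Lemma complement_card (l : 'I_3) : (#|H l| ^ 2 = #|G|)%N.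
Proof.
have [i [j /uniq3P[li lj ij]]] := ord3_others l.
have cM a b : a != b -> #|G| = (#|H a| * #|H b|)%N.
  by move=> ab; rewrite -(HM ab) TI_cardMg // HI.
have := cM _ _ lj; rewrite (cM _ _ li) => /eqP.
rewrite eqn_pmul2l ?cardG_gt0 //.
move/eqP=> eij; apply/eqP; rewrite -(eqn_pmul2r (cardG_gt0 (H i))).
have := cM _ _ ij; rewrite -eij (cM _ _ li) => /eqP.
by rewrite eqn_pmul2r ?cardG_gt0 // => /eqP ->; rewrite mulnn mulnC.
Qed.

Lemma complement_proper l : H l \proper G.
Proof.
rewrite properEneq sHG andbT; apply/eqP=> HG.
have [i [j /uniq3P[li _ _]]] := ord3_others l.
by have := HI li; rewrite HG (setIidPr (sHG i)) => /eqP; rewrite (negPf (H1 i)).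
Qed.

Lemma nu_complement l z : z \in H l -> z != 1%g -> (nu S z)%:Z = lam l.
Proof.
move=> zl z1; have [i [j uij]] := ord3_others l; have [li lj _] := uniq3P uij.
have out a : l != a -> z \in H a = false.
  move=> la; apply: contraNF z1 => za.
  by rewrite -in_set1 -[[set 1%g]](HI la) inE zl.
by rewrite nuS (big_ord3 _ uij) zl !out // mulr1 !mulr0 !addr0.
Qed.

(** A coefficient is nonzero and is a value of [nu S], hence positive. *)
Lemma lam_ge1 l : 1 <= lam l.
Proof.
have [z zH z1] := trivgPn _ (H1 l).
by have := lam0 l; rewrite -(nu_complement zH z1); lia.
Qed.

Lemma sum_lam : #|S|%:Z = \sum_l lam l.
Proof.
by rewrite -nu1 nuS; apply: eq_bigr => l _; rewrite group1 mulr1.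
Qed.

(** Summing [nu S] over the group gives [|S|^2 = |H l| * \sum_i lam i = |H l| |S|], the [H i] having
    equal orders. *)
Lemma complement_card_S l : #|H l| = #|S|.
Proof.
have m0 : (0 < #|S|)%N by rewrite card_gt0.
have cE i : #|H i| = #|H l|.
  by apply/eqP; rewrite -(@eqn_exp2r _ _ 2) // !complement_card.
suff: #|S|%:Z ^+ 2 = #|H l|%:Z * #|S|%:Z.
  rewrite expr2 => /eqP.
  by rewrite (inj_eq (mulIf _)) ?eqz_nat => [/eqP->|]; lia.
rewrite -rmorphXn -[(_ ^+ 2)%R]/((#|S| ^ 2)%N) -sum_nu_card -[LHS]natz natr_sum.
under eq_bigr => z _ do rewrite natz nuS.
rewrite exchange_big sum_lam mulr_sumr; apply: eq_bigr => i _ /=.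
rewrite -mulr_sumr mulrC -(cE i) -natr_sum natz; congr (_%:Z * _).
by rewrite -sum1_card [RHS]big_mkcond.
Qed.

Lemma diff_cover : {in S &, forall s s', (s * s'^-1)%g \in H o :|: H p :|: H q}.
Proof.
move=> s s' sS s'S; have: (0 < nu S (s * s'^-1)%g)%N.
  by apply/nu_gt0P; exists s, s'.
apply: contraTT; rewrite !inE !negb_or => /andP[/andP[no np] nq].
rewrite -eqn0Ngt -eqz_nat nuS (big_ord3 _ opq).
by rewrite (negPf no) (negPf np) (negPf nq) !mulr0 !addr0.
Qed.

(** [nu S] equals [lam l] at the [|S| - 1] nontrivial elements of [H l], and its sum over them is at
    most [|S|]. *)
Lemma lam_bound l : lam l * (#|S|%:Z - 1) <= #|S|%:Z.
Proof.
have [i [j uij]] := ord3_others l; have [li lj _] := uniq3P uij.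
have ncHl x : x \in S -> ~~ (S \subset H l :* x).
  by move=> xS; apply: ncS (complement_proper l) (subsetP sSG x xS).
have dS : {in S &, forall s s', (s * s'^-1)%g \in H l :|: H i :|: H j}.
  move=> s s' /diff_cover c /c; have cov a : H a \subset H l :|: H i :|: H j.
    apply/subsetP=> x xa; rewrite !inE -orbA.
    by case/or3P: (ord3_cover a uij) => /eqP<-; rewrite xa ?orbT.
  by rewrite [in X in X -> _]inE [in X in X -> _]inE -orbA;
    case/or3P; apply: subsetP (cov _) _.
have := sum_nu_le (HI li) (HI lj) ncHl dS.
rewrite -lez_nat -[X in X <= _]natz natr_sum.
rewrite (eq_bigr (fun _ => lam l)) => [|z /andP[zl z1]]; last first.
  by rewrite natz (nu_complement zl z1).
rewrite sumr_const (_ : #|_| = #|S|.-1); last first.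
  rewrite -(complement_card_S l) (cardsD1 1%g (H l)) group1 /=.
  by apply: eq_card => z; rewrite !inE andbC.
have m0 : (0 < #|S|)%N by rewrite card_gt0.
by rewrite -mulr_natr natz -subn1 -subzn.
Qed.

Lemma complement_lam_card : #|S| = 3%N /\ forall l, lam l = 1.
Proof.
have := sum_lam; rewrite (big_ord3 _ opq) => mE.
have lo := lam_ge1 o; have lp := lam_ge1 p; have lq := lam_ge1 q.
(* As [|S| >= 3], a coefficient of at least 2 would give [2(|S| - 1) <= |S|], which is absurd. *)
have l1 l : lam l = 1 by have := lam_ge1 l; have := lam_bound l; nia.
by split=> //; move: mE; rewrite !l1; lia.
Qed.

(* Here |G| = 9 and the H l are three of the four subgroups of order 3; the
   fourth one is the forbidden subgroup. *)
Lemma complement_relative_difference_set :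
  exists N : {group gT}, relative_difference_set G N 3 3 3 1 S.
Proof.
have [S3 l1] := complement_lam_card.
have H3 l : #|H l| = 3%N by rewrite complement_card_S.
have G9 : #|G| = 9%N by rewrite -(complement_card o) H3.
have nu_le1 z : z != 1%g -> (nu S z <= 1)%N.
  move=> z1; case: (posnP (nu S z)) => [->//|nz].
  have [l zl] : exists l, z \in H l.
    have [a [b [aS bS zE]]] := nu_gt0P _ _ nz.
    have := diff_cover aS bS; rewrite -zE !inE -orbA.
    by case/or3P; [exists o | exists p | exists q].
  by have := nu_complement zl z1; rewrite l1; lia.
have sum_nuG : (\sum_(z in G) nu S z)%N = 9%N.
  transitivity (#|S| ^ 2)%N; last by rewrite S3.
  rewrite -sum_nu_card big_mkcond; apply: eq_bigr => y _.
  by case: ifPn => // /(nu_out sSG) ->.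
have sum_nuG1 : (\sum_(z in G | z != 1%g) nu S z)%N = 6%N.
  by apply/eqP; rewrite -(eqn_add2l 3) -{1}S3 -(nu1 S) -(bigD1 1%g) //= sum_nuG.
have cardG1 (A : {group gT}) : #|[pred z | (z \in A) && (z != 1%g)]| = #|A|.-1.
  rewrite (cardsD1 1%g A) group1 /=; apply: eq_card => z.
  by rewrite !inE andbC.
(* The 8 nontrivial elements share a total of 6, so some [y] is not a difference; it will generate
   [N]. *)
have [y [yG y1 nuy]] : exists y, [/\ y \in G, y != 1%g & nu S y = 0%N].
  have [/existsP[y /and3P[yG y1 /eqP nuy]]|] :=
      boolP [exists y, [&& y \in G, y != 1%g & nu S y == 0%N]].
    by exists y.
  rewrite negb_exists => /forallP nz.
  have : (\sum_(z in G | z != 1%g) 1 <= \sum_(z in G | z != 1%g) nu S z)%N.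
    apply: leq_sum => z /andP[zG z1]; have := nz z.
    by rewrite zG z1 /= lt0n.
  by rewrite sum1_card cardG1 sum_nuG1 G9.
have yH l : y \notin H l.
  by apply/negP=> yl; have := nu_complement yl y1; rewrite nuy l1.
have y3 : (y ^+ 3 = 1)%g.
  have op : o != p by case: (uniq3P opq).
  have /mulsgP[a b aH bH ->] : y \in (H o * H p)%g by rewrite HM.
  have cab : commute a b.
    by apply: (centsP abG);
      [apply: subsetP (sHG o) _ aH | apply: subsetP (sHG p) _ bH].
  by rewrite expgMn // -{1}(H3 o) -(H3 p) !expg_cardG // mulg1.
have oy : #[y] = 3%N.
  have : #[y] \in divisors 3%N by rewrite -dvdn_divisors // order_dvdn y3.
  by rewrite !inE order_eq1 (negPf y1) /= => /eqP.
pose N := <[y]>%G; have N3 : #|N| = 3%N by [].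
have sNG : N \subset G by rewrite cycle_subG.
have NH l : N :&: H l = 1%g.
  by apply: prime_TIg; rewrite ?N3 // cycle_subG.
have nuN z : z \in N -> z != 1%g -> nu S z = 0%N.
  move=> zN z1; apply/eqP; rewrite -leqn0 leqNgt; apply/negP.
  case/nu_gt0P=> a [b [aS bS zE]].
  have out l : z \in H l = false.
    apply: contraNF z1 => zl.
    by rewrite -in_set1 -[[set 1%g]](NH l) inE zN.
  by have := diff_cover aS bS; rewrite -zE !inE !out.
(* [f] is at most 1 on the 8 nontrivial elements and sums to [6 + 2] there, so it is 1
   throughout. *)
pose f z := (nu S z + (z \in N))%N.
have f1 z : (z \in G) && (z != 1%g) -> (f z <= 1 ?= iff (f z == 1))%N.
  case/andP=> zG z1; split=> //; rewrite /f.
  by case: (boolP (z \in N)) => zN; [rewrite nuN | rewrite addn0 nu_le1].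
have [_] := leqif_sum f1; rewrite sum1_card cardG1 G9 big_split /= sum_nuG1.
rewrite -big_mkcondr /= sum1_card.
rewrite (_ : #|_| = 2%N); last first.
  rewrite -[RHS]/(3.-1)%N -N3 -(cardG1 N); apply: eq_card => z.
  rewrite [in RHS]inE [LHS]unfold_in -andbA andbCA andbC.
  by case: (boolP (z \in N)) => zN; rewrite ?andbF //= (subsetP sNG) ?andbT.
rewrite eqxx => /esym/forall_inP fE.
exists N; apply: relative_difference_set_nu; first by split; rewrite ?G9.
move=> z; have [->|z1] := eqVneq z 1%g; first by rewrite nu1 S3 !group1.
have [zG|zG] := boolP (z \in G).
  have /fE/eqP : (z \in G) && (z != 1%g) by rewrite zG.
  by rewrite /f; case: (z \in N); lia.
by rewrite (nu_out sSG zG) (negPf (contra (subsetP sNG z) zG)).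
Qed.
End PairwiseComplements.

(** * Case split on whether [G] is among the three subgroups *)

Theorem theorem4p19 (gT : finGroupType) (G : {group gT}) (S : {set gT}) :
  abelian G ->
  S \subset G ->
  primitive_formally_dual G S ->
  even_set_of_rank G S 3 ->
  exists (n : nat) (N : {group gT}),
    (1 < n)%N /\ relative_difference_set G N n n n 1 S.
Proof.
move=> abG sSG [chi [T [dchi sTG [ncS _] [ncT _] fdp]]].
move=> [[H [lam [Hlam SE]]] minr].
have sHG l : H l \subset G by case: (Hlam l).
have lam0 l : lam l != 0 by case: (Hlam l).
have nuS z : (nu S z)%:Z = \sum_l lam l * (z \in H l)%:R.
  rewrite -zg_set_mulVE SE sum_ffunE; apply: eq_bigr => l _.
  by rewrite zg_mulz zg_setE -mulrzl intz.
have injH (i j k : 'I_3) : uniq [:: i; j; k] -> H i :!=: H j.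
  exact: rank3_inj minr sHG SE.
have ncS' (A : {group gT}) x : A \proper G -> x \in G -> ~~ (S \subset A :* x).
  by move=> prA xG; apply/negP=> SA; apply: ncS; exists A, x.
have ncT' (A : {group gT}) x : A \proper G -> x \in G -> ~~ (T \subset A :* x).
  by move=> prA xG; apply/negP=> TA; apply: ncT; exists A, x.
have prH l : H l :!=: G -> H l \proper G by rewrite properEneq sHG andbT.
(* The [H l] are not all equal, so one is proper, and it would contain an empty [S]. *)
have S0 : S != set0.
  have [i [j uij]] := ord3_others ord0.
  have nG : [exists l, H l != G :> {set gT}].
    apply: contraT; rewrite negb_exists => /forallP allG.
    have := injH _ _ _ uij; have := allG ord0; have := allG i.
    by rewrite !negbK => /eqP-> /eqP->; rewrite eqxx.
  have [l /prH prl] := existsP nG; have := ncS' _ _ prl (group1 G).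
  by apply: contraNneq => ->; apply: sub0set.
pose P l := group (perp_group_set dchi (sHG l)).
have sPG l : P l \subset G by apply/subsetP=> y; rewrite inE => /andP[].
have coverS (i j k : 'I_3) : uniq [:: i; j; k] ->
    {in S &, forall s s', (s * s'^-1)%g \in H i :|: H j :|: H k}.
  by move=> u s s'; apply: (diff_cover nuS u).
have coverT (i j k : 'I_3) : uniq [:: i; j; k] ->
    {in T &, forall s s', (s * s'^-1)%g \in P i :|: P j :|: P k}.
  move=> u s s' sT s'T; have zG : (s * s'^-1)%g \in G.
    by rewrite groupM ?groupV ?(subsetP sTG).
  have: (0 < nu T (s * s'^-1)%g)%N by apply/nu_gt0P; exists s, s'.
  (* Outside all three annihilators the right side of [fdp_nu] vanishes, so [nu T] does too. *)
  apply: contraTT; rewrite !(in_setU _ _ (P _)) !negb_or.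
  case/andP=> /andP[ni nj] nk.
  have := fdp_nu dchi sSG fdp sHG nuS zG; rewrite (big_ord3 _ u).
  rewrite (negPf (ni : _ \notin perp chi (H i))).
  rewrite (negPf (nj : _ \notin perp chi (H j))).
  rewrite (negPf (nk : _ \notin perp chi (H k))) !mulr0 !addr0 => /eqP.
  rewrite !mulf_eq0 invr_eq0 !pnatr_eq0 (cards_eq0 S) (cards_eq0 T) (negPf S0).
  by rewrite (negPf (fdp_T0 dchi sSG S0 fdp)) /= => /eqP->.
have mulH (i j k : 'I_3) : uniq [:: i; j; k] -> H k :!=: G -> (H i * H j)%g = G.
  by move=> /coverS; apply: mulg_eq_of_differences.
have capH (i j k : 'I_3) :
    uniq [:: i; j; k] -> H k :!=: 1%g -> H i :&: H j = 1%g.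
  move=> u Hk; apply: (perp_mul_TI abG dchi (sHG i) (sHG j)).
  suff: (P i * P j)%g = G by [].
  apply: (mulg_eq_of_differences abG sTG (sPG i) (sPG j) (sPG k) ncT'
            (coverT _ _ _ u)).
  by apply: contra Hk => /eqP /(perp_eqG abG dchi (sHG k)) ->.
have chain (i j k : 'I_3) : uniq [:: i; j; k] -> H j :=: 1%g -> H k :=: G ->
    exists (n : nat) (N : {group gT}),
      (1 < n)%N /\ relative_difference_set G N n n n 1 S.
  move=> u Hj Hk; have [ij ik jk] := uniq3P u.
  have Hi1 : H i :!=: 1%g by rewrite -Hj; apply: injH u.
  have HiG : H i :!=: G.
    rewrite -Hk; apply: (injH _ _ j).
    by rewrite /= !inE negb_or ik ij eq_sym jk.
  have rds := chain_relative_difference_set abG dchi sSG sTG S0 fdp sHG lam0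
    nuS u Hi1 HiG Hj Hk.
  exists #|S|, (H i); split=> //; have [[_ _ <- _ _] _] := rds.
  by rewrite ltnNge -trivg_card_le1.
have [/existsP[k /eqP Hk]|] := boolP [exists k, H k == G :> {set gT}].
  have [i [j u]] := ord3_others k; have [ki kj ij] := uniq3P u.
  have [Hi|Hi] := eqVneq (H i : {set gT}) 1%g.
    apply: (chain j i k) => //.
    by rewrite /= !inE negb_or ![_ == k]eq_sym ki kj eq_sym ij.
  have [Hj|Hj] := eqVneq (H j : {set gT}) 1%g.
    apply: (chain i j k) => //.
    by rewrite /= !inE negb_or ![_ == k]eq_sym ki kj ij.
  (* If neither [H i] nor [H j] were trivial, [H i] would meet [H k = G] trivially: so 1 occurs
     along with [G]. *)
  have := capH k i j u Hj; rewrite Hk (setIidPr (sHG i)) => Hi'.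
  by rewrite Hi' eqxx in Hi.
rewrite negb_exists => /forallP HG.
have HM l l' : l != l' -> (H l * H l')%g = G.
  by move=> /ord3_third[k u]; apply: mulH u (HG k).
(* A trivial [H l] would make the product [H l * H i = G] equal to [H i], which is not [G]. *)
have H1 l : H l :!=: 1%g.
  have [i [j /uniq3P[li _ _]]] := ord3_others l.
  by apply: contra (HG i) => /eqP Hl; rewrite -(HM _ _ li) Hl mul1g.
have HI l l' : l != l' -> H l :&: H l' = 1%g.
  by move=> /ord3_third[k u]; apply: capH u (H1 k).
have [i [j u]] := ord3_others ord0.
have [N rds] := complement_relative_difference_set abG sSG S0 ncS' sHG lam0
  nuS H1 HM HI u.
by exists 3%N, N.
Qed.
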